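(* In the setting described in the context, let $\Xi\subset\mathbb{R}^L$ be $\mathrm{conv}(g(\mathcal{X}))$-maximal. Suppose there exists a feature map $\mathcal{A}:\mathcal{X}\to\mathbb{R}^L$ such that $\mathcal{A}(X)\in\mathcal{P}_\Xi(g(X))$ and $a=E[g(X)\mid\mathcal{A}(X)=a]$ for $\gamma$-almost every $(a,X)$, where $\gamma$ is the law of $(\mathcal{A}(X),X)$ with $X\sim p$. Then $\mathcal{A}$ is an optimal autoencoder.
   Context: Let $\mathcal{X}\subset\mathbb{R}^L$ be Borel, $p$ a probability measure on $\mathcal{X}$ with a Lebesgue density, $g:\mathcal{X}\to\mathbb{R}^L$ Borel and $W:\mathbb{R}^L\to\mathbb{R}$ of class $C^3$. An autoencoder is a Borel probability measure $\gamma$ on $\mathbb{R}^L\times\mathcal{X}$ with $\mathcal{X}$-marginal $p$ and $E_\gamma[g(X)\mid a]=a$ for $\gamma$-a.e. $a$; it is optimal if it maximizes $E_\gamma[W(a)]$ over all autoencoders. Define $c(a,b)=W(b)-W(a)+DW(a)(a-b)$ and $\mathcal{P}_\Xi(b)=\arg\min_{a\in\Xi}c(a,b)$. $\Xi$ is $Y$-maximal if $\inf_{a\in\Xi}c(a,b)\le0$ for all $b\in Y$. $\mathrm{conv}$ denotes convex hull. *)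

(* Defs.v *)
From HB Require Import structures.
From mathcomp Require Import all_boot all_order all_algebra.
From mathcomp Require Import all_classical all_reals all_analysis.
Import Order.TTheory GRing.Theory Num.Theory.
Import numFieldNormedType.Exports.
Set Implicit Arguments. Unset Strict Implicit. Unset Printing Implicit Defensive.
Local Open Scope classical_set_scope.
Local Open Scope ring_scope.

Section borel_rV.
Variables (R : realType) (L : nat).
HB.instance Definition _ := @isMeasurable.Build (sigma_display (@open 'rV[R]_L))
  'rV[R]_L <<s (@open 'rV[R]_L) >> (@sigma_algebra0 _ setT _)
  (@sigma_algebraC _ _) (@sigma_algebra_bigcup _ setT _).
End borel_rV.

Section autoencoder_defs.
Context {R : realType} {L : nat}.
Local Notation V := 'rV[R]_L.

Definition e_ (i : 'I_L) : V := delta_mx 0 i.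
Definition partial (i : 'I_L) (f : V -> R) : V -> R := fun a => 'D_(e_ i) f a.

Definition C3 (W : V -> R) : Prop :=
  continuous W /\
  forall i, (forall a, derivable W a (e_ i)) /\ continuous (partial i W) /\
  forall j, (forall a, derivable (partial i W) a (e_ j)) /\
            continuous (partial j (partial i W)) /\
  forall k, (forall a, derivable (partial j (partial i W)) a (e_ k)) /\
            continuous (partial k (partial j (partial i W))).

Definition cost (W : V -> R) (a b : V) : R := W b - W a + 'd W a (a - b).

Definition proj_set (W : V -> R) (Xi : set V) (b : V) : set V :=
  [set a | Xi a /\ forall a', Xi a' -> cost W a b <= cost W a' b].

Definition maximal (W : V -> R) (Y Xi : set V) : Prop :=
  forall b, Y b -> (ereal_inf [set (cost W a b)%:E | a in Xi] <= 0)%E.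

Definition conv_hull (S : set V) : set V :=
  [set b | exists n (w : 'I_n -> R) (x : 'I_n -> V),
     (forall k, 0 <= w k) /\ \sum_(k < n) w k = 1 /\ (forall k, S (x k)) /\
     b = \sum_(k < n) w k *: x k].

Definition box (lo hi : V) : set V := [set x | forall i, lo 0 i <= x 0 i <= hi 0 i].
Definition box_vol (lo hi : V) : R := \prod_(i < L) (hi 0 i - lo 0 i).
Definition lebesgue_null (A : set V) : Prop :=
  forall eps : R, 0 < eps -> exists lo hi : nat -> V,
    (forall k i, lo k 0 i <= hi k 0 i) /\
    A `<=` \bigcup_k box (lo k) (hi k) /\
    (\sum_(0 <= k <oo) (box_vol (lo k) (hi k))%:E <= eps%:E)%E.

(* p has a Lebesgue density (absolute continuity w.r.t. Lebesgue measure) *)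
Definition has_lebesgue_density (p : probability V R) : Prop :=
  forall A, measurable A -> lebesgue_null A -> p A = 0.

(* E_gam[g(X) | a] = a : the (componentwise) defining property of
   conditional expectation given the sigma-algebra generated by a,
   i.e. by the sets A x R^L, A Borel. *)
Definition cond_exp_is_id (g : V -> V) (gam : probability (V * V)%type R) : Prop :=
  (forall i, gam.-integrable setT (fun z => (g z.2 0 i)%:E)) /\
  (forall i, gam.-integrable setT (fun z => (z.1 0 i)%:E)) /\
  (forall A, measurable A -> forall i,
     (\int[gam]_(z in A `*` setT) (g z.2 0 i)%:E =
      \int[gam]_(z in A `*` setT) (z.1 0 i)%:E)%E).

Definition autoencoder (p : probability V R) (g : V -> V)
    (gam : probability (V * V)%type R) : Prop :=
  (forall B, measurable B -> gam (setT `*` B) = p B) /\ cond_exp_is_id g gam.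

Definition optimal_autoencoder (p : probability V R) (g : V -> V) (W : V -> R)
    (gam : probability (V * V)%type R) : Prop :=
  autoencoder p g gam /\
  forall gam' : probability (V * V)%type R, autoencoder p g gam' ->
    (\int[gam']_z (W z.1)%:E <= \int[gam]_z (W z.1)%:E)%E.

End autoencoder_defs.

(* Main.v *)
Require Import Defs.
From HB Require Import structures.
From mathcomp Require Import all_boot all_order all_algebra.
From mathcomp Require Import all_classical all_reals all_analysis.
From mathcomp Require Import measurable_realfun ring lra.
Import Order.TTheory GRing.Theory Num.Theory.
Import numFieldNormedType.Exports.
Import HBSimple HBNNSimple.
Local Open Scope classical_set_scope.
Local Open Scope ring_scope.

Set Implicit Arguments.
Unset Strict Implicit.
Unset Printing Implicit Defensive.

(** Write [tangent a b] for the value at [b] of the affine map tangent to [W] at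
    [a], so that the cost is [W b - tangent a b] and maximality says that [W] is
    bounded on [conv (g X)] by the convex function [phi], the supremum of
    [tangent a] over [a] in [Xi].  The feature map realises this supremum at [g x],
    so [phi (g x) = tangent (A x) (g x)], whose conditional expectation given [A]
    is [W (A x)].  For any other autoencoder, Jensen's inequality gives
    [E W(a) <= E phi(a) <= E phi(g(X)) = E W(A)].

    Nothing but [g] and [a] is assumed integrable.  One tangent map
    [tangent a0], [a0] in [Xi], is subtracted throughout to obtain nonnegative
    integrands, and the first identity is localised to sets where [W] and its
    gradient are bounded.  Jensen's inequality is proved without disintegration:
    the [a]-space is cut into countably many cells on which [W] is almost
    constant, and each cell is replaced by the mean of [g(X)] over it, which lies
    in [conv (g X)] itself, not merely in its closure, by an induction on the
    dimension. *)

(** * Coordinates, sup norm and dot product of row vectors *)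

Lemma ler_coord_norm (R : realType) n (v : 'rV[R]_n) i : `|v 0 i| <= `|v|.
Proof.
rewrite [leRHS]/Num.norm /= mx_normrE.
exact: (le_bigmax _ (fun ij : 'I_1 * 'I_n => `|v ij.1 ij.2|) (0, i)).
Qed.

Lemma norm_rV_le (R : realType) n (v : 'rV[R]_n) (e : R) :
  0 <= e -> (forall i, `|v 0 i| <= e) -> `|v| <= e.
Proof.
move=> e0 ve; rewrite [leLHS]/Num.norm /= mx_normrE.
by apply/bigmax_leP; split => // -[i j] _ /=; rewrite ord1.
Qed.

Definition dotr {R : realType} {n} (c v : 'rV[R]_n) : R :=
  \sum_(i < n) c 0 i * v 0 i.

Section dotr.
Variables (R : realType) (n : nat).
Implicit Types c v w : 'rV[R]_n.

Lemma dotr_is_linear c : linear (dotr c).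
Proof.
move=> k u v; rewrite /dotr scaler_sumr -big_split /=.
by apply: eq_bigr => i _; rewrite !mxE mulrDr mulrCA.
Qed.

HB.instance Definition _ c :=
  GRing.isLinear.Build R 'rV[R]_n R _ (dotr c) (dotr_is_linear c).

Lemma dotrC c v : dotr c v = dotr v c.
Proof. by apply: eq_bigr => i _; rewrite mulrC. Qed.

Lemma dotr_continuous c : continuous (dotr c).
Proof.
apply: continuous_big => [|i _]; first exact: add_continuous.
move=> v; apply: (@continuous_comp _ _ _ (fun v : 'rV[R]_n => v 0 i)).
  exact: coord_continuous.
exact: mulrl_continuous.
Qed.

End dotr.

(** * Differentiability from continuous partial derivatives *)

Section C1_differential.
Context {R : realType} {L : nat}.
Local Notation V := 'rV[R]_L.
Variable W : V -> R.
Hypothesis dW : forall i a, derivable W a (e_ i).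

Lemma norm_e_le1 (i : 'I_L) : `|e_ i : V| <= 1.
Proof.
by apply: norm_rV_le => // j; rewrite mxE eqxx /=; case: eqP => _;
  rewrite ?normr1 ?normr0 ?ler01.
Qed.

Lemma is_derive_along (i : 'I_L) (x : V) (t : R) :
  is_derive t 1 (fun s => W (x + s *: e_ i)) (partial i W (x + t *: e_ i)).
Proof.
have E : (fun h => h^-1 *: (((fun s => W (x + s *: e_ i)) \o shift t) (h *: 1)
     - W (x + t *: e_ i))) =
   (fun h => h^-1 *: ((W \o shift (x + t *: e_ i)) (h *: e_ i) -
     W (x + t *: e_ i))) :> (R -> R).
  apply/funext => h /=; congr (_ *: (W _ - _)).
  by rewrite [h *: 1]mulr1 scalerDl addrCA.
by split; rewrite /derivable /partial /derive E; [exact: dW|].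
Qed.

(** Only the size of [c] matters later, so both signs of [s] share one statement. *)
Lemma MVT_along (i : 'I_L) (x : V) (s : R) : exists2 c : R, `|c| <= `|s| &
  W (x + s *: e_ i) - W x = partial i W (x + c *: e_ i) * s.
Proof.
have cf A : {within A, continuous (fun s => W (x + s *: e_ i))}.
  apply: continuous_subspaceT => t; apply: differentiable_continuous.
  by apply/derivable1_diffP; have [] := is_derive_along i x t.
have D (A : interval R) (t : R) : t \in A -> is_derive t 1 (fun s => W (x + s *: e_ i))
  ((fun t => partial i W (x + t *: e_ i)) t).
  by move=> _; exact: is_derive_along.
have [s0|s0] := leP 0 s.
  have [c] := MVT_segment s0 (D `]0, s[%R) (cf _).
  rewrite in_itv/= scale0r addr0 subr0 => /andP[c0 cs] E.
  by exists c => //; rewrite !ger0_norm.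
have [c] := MVT_segment (ltW s0) (D `]s, 0[%R) (cf _).
rewrite in_itv/= scale0r addr0 => /andP[sc c0] E.
exists c; first by rewrite !ler0_norm ?lerN2// ltW.
by rewrite -opprB E sub0r mulrN opprK.
Qed.

Hypothesis cW : forall i, continuous (partial i W).

(** Moving from [a] to [a + v] one coordinate at a time, the mean value theorem turns each increment
    of [W] into a partial derivative at a point near [a], which continuity replaces by the one at
    [a]. *)
Lemma C1_diffE (a : V) : 'd W a = dotr (\row_i partial i W a) :> (V -> R).
Proof.
apply: diff_unique; first exact: dotr_continuous.
apply/eqaddoP => _/posnumP[e].
(* Each of the [L] legs costs at most [eta * |v|]; dividing by [L + 1] keeps the total below
   [e * |v|], also when [L = 0]. *)
pose eta := e%:num / L.+1%:R.
have eta0 : 0 < eta by rewrite divr_gt0.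
have : \forall y \near a, forall i, `|partial i W y - partial i W a| <= eta.
  apply: (@filter_forall V 'I_L _ (nbhs a) _) => i; have /cvgrPdist_le/(_ _ eta0)  := @cW i a.
  by apply: filterS => y; rewrite distrC.
move=> /nbhs_ballP[d /= d0 Hd].
(* All intermediate points lie within [(L + 1) * |v|] of [a]. *)
apply/nbhs_ballP; exists (d / L.+1%:R) => /=; first by rewrite divr_gt0.
move=> v; rewrite -ball_normE /= sub0r normrN ltr_pdivlMr// => vd.
pose tr s : V := \sum_(i <- s) v 0 i *: e_ i.
have tr_le s : `|tr s| <= (size s)%:R * `|v|.
  rewrite /tr; elim: s => [|i s IH]; first by rewrite big_nil normr0 mul0r.
  rewrite big_cons /= -natr1 mulrDl mul1r addrC (le_trans (ler_normD _ _))//.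
  rewrite lerD// normrZ -[leRHS]mulr1 ler_pM// ?norm_e_le1//.
  exact: ler_coord_norm.
have key s : (size s <= L)%N ->
  `|W (a + tr s) - W a - \sum_(i <- s) partial i W a * v 0 i|
    <= (size s)%:R * (eta * `|v|).
  elim: s => [_|i s IH /= sL].
    by rewrite /tr !big_nil addr0 subrr subr0 normr0 mul0r.
  rewrite {1}/tr !big_cons -/(tr s) (addrC (_ *: _)) addrA.
  have [c cv E] := MVT_along i (a + tr s) (v 0 i).
  rewrite (_ : _ - _ = (partial i W (a + tr s + c *: e_ i) - partial i W a)
     * v 0 i + (W (a + tr s) - W a - \sum_(j <- s) partial j W a * v 0 j)).
    rewrite -natr1 [leRHS]mulrDl mul1r addrC (le_trans (ler_normD _ _))//.
    rewrite lerD ?IH ?(ltnW sL)// normrM ler_pM ?ler_coord_norm//.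
    apply: Hd; rewrite -ball_normE/= -addrA opprD addNKr normrN.
    rewrite (le_lt_trans _ vd)// (le_trans (ler_normD _ _))//.
    rewrite -natr1 mulrDr mulr1 lerD//.
      by rewrite (le_trans (tr_le s))// mulrC ler_wpM2l// ler_nat ltnW.
    rewrite normrZ -[leRHS]mulr1 ler_pM// ?norm_e_le1//.
    by rewrite (le_trans cv)// ler_coord_norm.
  move: E; set A := W (a + tr s + _); set B := W (a + tr s).
  move=> E; have -> : A = B + (A - B) by ring.
  by rewrite E; ring.
have := key (index_enum 'I_L).
rewrite /index_enum -enumT size_enum_ord => /(_ (leqnn _)).
have -> : tr (enum 'I_L) = v.
  by rewrite /tr big_enum/= [RHS]row_sum_delta.
rewrite -![(_ + _ : _ -> _) _]/(_ + _) -![(- _ : _ -> _) _]/(- _) /= opprD.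
rewrite addrA (addrC v a) /cst => /le_trans; rewrite /dotr.
have -> : \sum_(i <- enum 'I_L) partial i W a * v 0 i =
   \sum_(i < L) (\row_j partial j W a) 0 i * v 0 i.
  by rewrite big_enum; apply: eq_bigr => i _; rewrite mxE.
apply; rewrite mulrA ler_wpM2r// /eta mulrCA ger_pMr//.
by rewrite ler_pdivrMr// mul1r ler_nat.
Qed.

End C1_differential.

(** * Gordan's theorem of the alternative, for finite families and for arbitrary sets *)

Section gordan.
Variables (R : realType) (d : nat).
Local Notation V := 'rV[R]_d.

Let simplex n : set 'rV[R]_n :=
  [set w : 'rV[R]_n | (forall i, 0 <= w 0 i) /\ dotr (const_mx 1) w = 1].

Let simplex_compact n : compact (@simplex n).
Proof.
apply: bounded_closed_compact.
  exists 1; split; first by rewrite num_real.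
  move=> M M1 w [w0 w1]; apply: norm_rV_le => [|i].
    by rewrite (le_trans ler01)// ltW.
  rewrite ger0_norm// (le_trans _ (ltW M1))// -w1 /dotr (bigD1 i)//= mxE mul1r.
  by rewrite lerDl sumr_ge0// => j _; rewrite mxE mul1r.
rewrite (_ : @simplex n = \bigcap_i [set w : 'rV[R]_n | 0 <= w 0 i] `&`
    dotr (const_mx 1) @^-1` [set 1]); last first.
  by apply/seteqP; split=> w [w0 w1]; split => // i; [move=> _|]; exact: w0.
apply: closedI.
  apply: closed_bigI => i _.
  apply: (@preimage_closed _ _ (fun w : 'rV[R]_n => w 0 i) [set x | 0 <= x]).
    by move=> w _; exact: coord_continuous.
  exact: closed_ge.
apply: preimage_closed; first by move=> w _; exact: dotr_continuous.
exact/accessible_closed_set1/hausdorff_accessible/Rhausdorff.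
Qed.

(* The point of least Euclidean norm in the convex hull of the [x k], if not
   zero, would have a nonnegative scalar product with every [x k]. *)
Lemma finite_gordan n (x : 'I_n.+1 -> V) :
  (forall u, u != 0 -> exists k, dotr u (x k) < 0) ->
  exists w : 'I_n.+1 -> R, [/\ forall k, 0 <= w k,
    \sum_(k < n.+1) w k = 1 & \sum_(k < n.+1) w k *: x k = 0].
Proof.
move=> xP.
pose y (w : 'rV[R]_n.+1) : V := \sum_(k < n.+1) w 0 k *: x k.
have yD t (w w' : 'rV[R]_n.+1) : y (w + t *: (w' - w)) = y w + t *: (y w' - y w).
  rewrite /y -sumrB scaler_sumr -big_split/=; apply: eq_bigr => k _.
  by rewrite !mxE scalerDl -scalerBl scalerA.
have cphi : continuous (fun w => dotr (y w) (y w)).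
  apply: continuous_big => [|i _]; first exact: add_continuous.
  have cy : continuous (fun w => y w 0 i).
    rewrite (_ : (fun w => _) = dotr (\row_k x k 0 i)).
      exact: dotr_continuous.
    apply/funext => w; rewrite /y summxE; apply: eq_bigr => k _.
    by rewrite !mxE mulrC.
  by move=> w; exact: (cvgM (cy w) (cy w)).
have delta_simplex k : simplex (delta_mx 0 k : 'rV[R]_n.+1).
  split=> [i|]; first by rewrite mxE ler0n.
  rewrite /dotr (bigD1 k)//= big1 ?addr0 => [|i ik]; rewrite !mxE ?eqxx ?mulr1//.
  by rewrite (negbTE ik) andbF mulr0.
have [|w /set_mem[w0 w1] wmin] := EVT_min_rV _ (@simplex_compact n.+1)
    (continuous_subspaceT cphi).
  by exists (delta_mx 0 ord0).
exists (w 0); split => //.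
  by rewrite -[RHS]w1; apply: eq_bigr => i _; rewrite mxE mul1r.
apply/eqP; apply: contraT => v0.
have {v0} [k xk] := xP _ v0; rewrite -/(y w) in xk.
have yk : y (delta_mx 0 k) = x k.
  rewrite /y (bigD1 k)//= big1 ?addr0 => [|i ik]; rewrite mxE ?eqxx ?scale1r//.
  by rewrite (negbTE ik) andbF scale0r.
set v := y w in xk.
have vv : 0 <= dotr v v by apply: sumr_ge0 => i _; rewrite -expr2 sqr_ge0.
pose B := dotr v (x k - v); pose N := dotr (x k - v) (x k - v).
have B0 : B < 0 by rewrite /B linearB /= subr_lt0 (lt_le_trans xk).
have N0 : 0 <= N by apply: sumr_ge0 => i _; rewrite -expr2 sqr_ge0.
(* Moving from [v] towards [x k] changes the squared norm by [t * (2 * B + t * N)], at most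
   [t * B < 0] once [t * N <= - B]: this contradicts minimality. The cap at 1 keeps the weights in
   the simplex, and the added 1 guards against [N = 0]. *)
pose t := Num.min 1 (- B / (N + 1)).
have t0 : 0 < t by rewrite lt_min ltr01 divr_gt0 ?oppr_gt0// ltr_wpDl.
have t1 : t <= 1 by rewrite ge_min lexx.
have tN : t * N <= - B.
  have : t <= - B / (N + 1) by rewrite ge_min lexx orbT.
  by rewrite ler_pdivlMr ?ltr_wpDl// mulrDr mulr1; lra.
have wt : w + t *: (delta_mx 0 k - w) \in @simplex n.+1.
  apply/mem_set; split => [i|].
    have := w0 i; have : 0 <= (delta_mx 0 k : 'rV[R]_n.+1) 0 i.
      by rewrite mxE ler0n.
    rewrite !mxE; nra.
  rewrite linearD linearZ linearB /= w1.
  by have [_ ->] := delta_simplex k; rewrite subrr scaler0 addr0.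
have := wmin _ wt; rewrite yD yk -/v.
rewrite linearD linearZ /= !(dotrC (v + _)) !linearD !linearZ /=.
rewrite (dotrC (x k - v) v) -/B -/N /GRing.scale /=; nra.
Qed.

(** The open half-spaces [dotr x u < 0], with [x] in [S], cover the compact unit sphere; a finite
    subcover reduces the claim to [finite_gordan]. *)
Lemma gordan (S : set V) : S !=set0 ->
  (forall u, u != 0 -> exists2 x, S x & dotr u x < 0) -> conv_hull S 0.
Proof.
move=> [x0 Sx0] SP.
have : compact [set u : V | `|u| = 1].
  apply: bounded_closed_compact.
    exists 1; split; first by rewrite num_real.
    by move=> M M1 u /= ->; rewrite ltW.
  apply: (@preimage_closed _ _ (fun u : V => `|u|) [set 1]).
    by move=> u _; exact: norm_continuous.
  exact/accessible_closed_set1/hausdorff_accessible/Rhausdorff.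
rewrite compact_cover => /(_ V S (fun x => [set u | dotr x u < 0])) [].
- move=> x _; apply: (@open_comp _ _ (dotr x) [set r | r < 0]).
    by move=> u _; exact: dotr_continuous.
  exact: open_lt.
- move=> u /= u1; have u0 : u != 0 by rewrite -normr_eq0 u1 oner_neq0.
  by have [x Sx ux] := SP _ u0; exists x => //=; rewrite dotrC.
move=> D' D'S cov.
(* Prefixing [x0] makes the family nonempty even if the sphere is empty, as in dimension 0. *)
pose D := finmap.enum_fset D'; pose s : seq V := x0 :: D.
have sS z : z \in s -> S z.
  by rewrite inE => /predU1P[->//|/D'S]; rewrite inE.
pose x (k : 'I_(size D).+1) := nth 0 s k.
have [|w [w0 w1 wx]] := @finite_gordan _ x.
  move=> u u0.
  have [|z /= zD] := cov (`|u|^-1 *: u).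
    by rewrite /= normrZ normfV normr_id mulVf ?normr_eq0.
  rewrite linearZ /= pmulr_rlt0 ?invr_gt0 ?normr_gt0// => zu.
  have zs : z \in s by rewrite inE zD orbT.
  have zi : (index z s < (size D).+1)%N by rewrite -[ltnRHS]/(size s) index_mem.
  by exists (Ordinal zi); rewrite /x/= nth_index// dotrC.
exists (size D).+1, w, x; split => //; split => //; split => // k.
by apply: sS; rewrite mem_nth.
Qed.

End gordan.

(** * Means of random vectors lie in convex hulls *)

Lemma ae_nonempty {disp : measure_display} {T : measurableType disp}
    {R : realType} (mu : {measure set T -> \bar R}) (D : set T) U (h : T -> U)
    (A : set U) :
  measurable D -> (0 < mu D)%E -> {ae mu, forall z, D z -> A (h z)} -> A !=set0.
Proof.
move=> mD D0 hA; apply/set0P/eqP => A0; move: D0.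
rewrite measure_negligible ?ltxx//.
by apply: negligibleS hA => z Dz /= /(_ Dz); rewrite A0.
Qed.

Section mean_in_conv_hull.
Context {disp : measure_display} {T : measurableType disp} {R : realType}.
Variables (mu : {measure set T -> \bar R}) (D : set T).
Hypothesis mD : measurable D.

Lemma integrable_dotr n (f : T -> 'rV[R]_n) (c : 'rV[R]_n) :
  (forall i, mu.-integrable D (fun z => (f z 0 i)%:E)) ->
  mu.-integrable D (fun z => (dotr c (f z))%:E).
Proof.
move=> fi; under eq_fun do rewrite /dotr -sumEFin.
apply: integrable_sum => // i _.
by under eq_fun do rewrite EFinM; exact: integrableZl.
Qed.

Lemma integral_dotr n (f : T -> 'rV[R]_n) (c : 'rV[R]_n) :
  (forall i, mu.-integrable D (fun z => (f z 0 i)%:E)) ->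
  (\int[mu]_(z in D) (dotr c (f z))%:E =
   \sum_(i < n) (c 0 i)%:E * \int[mu]_(z in D) (f z 0 i)%:E)%E.
Proof.
move=> fi; under eq_integral do rewrite /dotr -sumEFin.
rewrite integral_sum// => [|i]; last first.
  by under eq_fun do rewrite EFinM; exact: integrableZl.
apply: eq_bigr => i _.
by under eq_integral do rewrite EFinM; exact: integralZl.
Qed.

Hypothesis D0 : (0 < mu D)%E.

Lemma zero_mean_in_conv_hull n (f : T -> 'rV[R]_n) (S : set 'rV[R]_n) :
  (forall i, mu.-integrable D (fun z => (f z 0 i)%:E)) ->
  (forall i, \int[mu]_(z in D) (f z 0 i)%:E = 0)%E ->
  {ae mu, forall z, D z -> S (f z)} -> conv_hull S 0.
Proof.
elim: n f S => [|n IH] f S fi f0 fS.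
  by apply: gordan => [|u]; [exact: ae_nonempty mD D0 fS|rewrite [u]thinmx0 eqxx].
have [[u [u0 uf]]|nuf] := pselect (exists u : 'rV[R]_n.+1, u != 0 /\
    {ae mu, forall z, D z -> dotr u (f z) = 0}).
  have [i ui] : exists i, u 0 i != 0 by apply/rV0Pn.
  (* On the hyperplane orthogonal to [u], coordinate [i] is the linear function [c] of the others;
     [ext] restores it. *)
  pose c : 'rV[R]_n := \row_k (- (u 0 i)^-1 * u 0 (lift i k)).
  pose ext (x : 'rV[R]_n) : 'rV[R]_n.+1 :=
    \row_j if unlift i j is Some k then x 0 k else dotr c x.
  have extE m (w : 'I_m -> R) (x : 'I_m -> 'rV[R]_n) :
      ext (\sum_(k < m) w k *: x k) = \sum_(k < m) w k *: ext (x k).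
    apply/rowP => j; rewrite summxE mxE; case: unliftP => [k ->|->].
      by rewrite summxE; apply: eq_bigr => l _; rewrite !mxE liftK.
    rewrite linear_sum; apply: eq_bigr => l _.
    by rewrite linearZ !mxE unlift_none.
  have [] := IH (fun z => \row_k f z 0 (lift i k)) [set x | S (ext x)].
  - by move=> k; apply: eq_integrable (fi (lift i k)) => // z _; rewrite mxE.
  - by move=> k; rewrite -[RHS](f0 (lift i k)); apply: eq_integral => z _; rewrite mxE.
  - apply: filterS2 uf fS => z uz Sz Dz /=; rewrite (_ : ext _ = f z); first exact: Sz.
    apply/rowP => j; rewrite mxE; case: unliftP => [k ->|->]; first by rewrite mxE.
    have := uz Dz; rewrite /dotr (bigD1_ord i)//= => /eqP.
    rewrite addr_eq0 => /eqP E; apply: (mulfI ui); rewrite E mulr_sumr -sumrN.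
    by apply: eq_bigr => k _; rewrite !mxE !mulrA mulrN divff// mulN1r mulNr.
  move=> m [w [x [w0 [w1 [Sx x0]]]]].
  exists m, w, (fun k => ext (x k)); split => //; split => //; split => //.
  rewrite -extE -x0; apply/rowP => j; rewrite !mxE.
  by case: unliftP => [k _|_]; rewrite ?mxE// linear0.
apply: gordan; first exact: ae_nonempty mD D0 fS.
move=> u u0; apply: contra_notP nuf => Su; exists u; split => //.
have pos : {ae mu, forall z, D z -> 0 <= dotr u (f z)}.
  apply: filterS fS => z Sz Dz; rewrite leNgt; apply/negP => ux.
  by apply: Su; exists (f z) => //; exact: Sz.
have ui := integrable_dotr u fi.
have mu_ := measurable_int mu ui.
suff : ae_eq mu D (fun z => (dotr u (f z))%:E) (cst 0%E).
  by apply: filterS => z /[swap] Dz /(_ Dz) [].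
apply/(ae_eq_integral_abs mu mD mu_).
rewrite (ae_eq_integral (fun z => (dotr u (f z))%:E))//.
- by rewrite integral_dotr// big1// => i _; rewrite f0 mule0.
- exact: measurableT_comp.
- by apply: filterS pos => z /[swap] Dz /(_ Dz) z0; rewrite gee0_abs.
Qed.

End mean_in_conv_hull.

(** * Functions with zero conditional expectation given [X] *)

Section conditional_orthogonality.
Context {d1 d2 : measure_display} {T : measurableType d1} {U : measurableType d2}
  {R : realType}.
Variables (mu : {measure set T -> \bar R}) (X : T -> U).
Hypothesis mX : measurable_fun setT X.

Lemma measurable_preim (A : set U) : measurable A -> measurable (X @^-1` A).
Proof. by move=> mA; rewrite -[_ @^-1` _]setTI; exact: mX. Qed.

Section scalar.
Variable D : T -> R.
Hypothesis Di : mu.-integrable setT (EFin \o D).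
Hypothesis D0 : forall A, measurable A ->
  (\int[mu]_(z in X @^-1` A) (D z)%:E = 0)%E.

(** The product splits over the finitely many level sets of [s], on whose preimages [D] integrates
    to zero. *)
Let orth_nnsfun (s : {nnsfun U >-> R}) :
  (\int[mu]_z (s (X z) * D z)%:E = 0)%E.
Proof.
have ms y : measurable (s @^-1` [set y]) by exact/measurable_sfunP.
have mA y := measurable_preim (ms y).
pose h (y : R) (z : T) := ((EFin \o D) \_ (X @^-1` (s @^-1` [set y]))) z.
have hi y : mu.-integrable setT (h y).
  by apply/(integrable_mkcond _ (mA y)); exact: integrableS Di.
transitivity (\int[mu]_z \sum_(y <- finmap.enum_fset (fset_set (range s)))
    y%:E * h y z)%E.
  apply: eq_integral => z _; rewrite fimfunE fsbig_finite//= mulr_suml -sumEFin.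
  apply: eq_bigr => y _; rewrite -mulrA EFinM; congr (_ * _)%E.
  rewrite /h patchE indicE /=.
  have -> : (z \in X @^-1` (s @^-1` [set y])) = (X z \in s @^-1` [set y]).
    by apply/idP/idP; rewrite !inE.
  by case: ifP => _; rewrite ?mul1r ?mul0r.
rewrite integral_sum//= => [|y]; last exact: integrableZl.
rewrite big1// => y _; rewrite integralZl// -integral_mkcond.
by rewrite D0 ?mule0.
Qed.

(** Dominated convergence along simple approximations of [psi], with dominating function
    [M * |D|]. *)
Let orth_nonneg (psi : U -> R) (M : R) : measurable_fun setT psi ->
  (forall a, 0 <= psi a <= M) -> (\int[mu]_z (psi (X z) * D z)%:E = 0)%E.
Proof.
move=> mpsi psiM.
have mE : measurable_fun setT (EFin \o psi) by exact/measurable_EFinP.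
pose s := nnsfun_approx measurableT mE.
have psi0 a : setT a -> (0 <= (EFin \o psi) a)%E.
  by move=> _ /=; rewrite lee_fin; case/andP: (psiM a).
have mD : measurable_fun setT D by apply/measurable_EFinP/(measurable_int mu Di).
have [|||||_ _] := @dominated_convergence _ _ _ mu _ measurableT
  (fun n z => (s n (X z) * D z)%:E) (fun z => (psi (X z) * D z)%:E)
  (fun z => (M%:E * `|(D z)%:E|)%E).
- move=> n; apply/measurable_EFinP/measurable_funM => //.
  exact: measurableT_comp.
- by apply/measurable_EFinP/measurable_funM => //; exact: measurableT_comp.
- apply: aeW => z _; apply: cvg_EFin; first by apply: nearW.
  apply: cvgM; last exact: cvg_cst.
  have := @cvg_approx _ _ _ setT (EFin \o psi) (X z) psi0 I (ltry _).
  by under eq_cvg do rewrite -(nnsfun_approxE measurableT mE).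
- by apply: integrableZl => //; exact: integrable_abse.
- apply: aeW => z n _; rewrite EFinM abseM lee_wpmul2r//.
  rewrite lee_fin ger0_norm//; have /andP[_] := psiM (X z).
  apply: le_trans; rewrite /s nnsfun_approxE -lee_fin.
  exact: (le_approx (f := EFin \o psi)).
under eq_fun do rewrite orth_nnsfun.
by move=> /(cvg_unique _)/(_ (cvg_cst _)) ->.
Qed.

Lemma integral_mul_bounded_eq0 (psi : U -> R) (M : R) (A : set U) :
  measurable A -> measurable_fun setT psi -> (forall a, A a -> `|psi a| <= M) ->
  mu.-integrable (X @^-1` A) (fun z => (psi (X z) * D z)%:E) /\
  (\int[mu]_(z in X @^-1` A) (psi (X z) * D z)%:E = 0)%E.
Proof.
move=> mA mpsi psiM; have mXA := measurable_preim mA.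
have DiA := integrableS measurableT mXA (@subsetT _ _) Di.
have i1 : mu.-integrable (X @^-1` A) (fun z => (psi (X z) * D z)%:E).
  under eq_fun do rewrite EFinM.
  apply: (integrableMr mXA (h := psi \o X) (g := EFin \o D)) => //.
    by apply: measurable_funTS; exact: measurableT_comp.
  exists M; split; first exact: num_real.
  by move=> N MN z /= Az; rewrite (le_trans (psiM _ Az))// ltW.
split => //.
(* The shift by [M0] makes the factor nonnegative and the indicator confines it to [A]; the shift
   adds nothing, as [D] integrates to zero over the preimage of [A]. *)
pose M0 := Num.max 0 M.
pose psi' a := \1_A a * (psi a + M0).
have : (\int[mu]_z (psi' (X z) * D z)%:E = 0)%E.
  apply: (@orth_nonneg _ (M0 + M0)).
    apply: measurable_funM; first exact: measurable_indic.
    by apply: measurable_funD.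
  move=> a; rewrite /psi' indicE; have M00 : 0 <= M0 by rewrite le_max lexx.
  have [/set_mem/psiM|_] := boolP (a \in A); last by rewrite mul0r lexx addr_ge0.
  rewrite mul1r ler_norml => /andP[h1 h2].
  have MM : M <= M0 by rewrite le_max lexx orbT.
  by apply/andP; split; lra.
have -> : (\int[mu]_z (psi' (X z) * D z)%:E =
   \int[mu]_(z in X @^-1` A) ((psi (X z) * D z)%:E + M0%:E * (D z)%:E))%E.
  rewrite [RHS]integral_mkcond; apply: eq_integral => z _.
  rewrite patchE /psi' indicE.
  have -> : (z \in X @^-1` A) = (X z \in A) by apply/idP/idP; rewrite !inE.
  case: ifP => _; last by rewrite !mul0r.
  by rewrite mul1r -EFinM -EFinD mulrDl.
rewrite integralD//; last exact: integrableZl.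
by rewrite integralZl// D0// mule0 adde0.
Qed.

End scalar.

(* [F >= 0] has conditional expectation [q] given [X], but only on each set where
   [q] and [H] are bounded: [F] itself need not be integrable. *)
Lemma cond_exp_nonneg n (D : T -> 'rV[R]_n) (q : U -> R) (H : U -> 'rV[R]_n) :
  (mu setT < +oo)%E ->
  (forall i, mu.-integrable setT (fun z => (D z 0 i)%:E)) ->
  (forall i A, measurable A -> \int[mu]_(z in X @^-1` A) (D z 0 i)%:E = 0)%E ->
  measurable_fun setT q ->
  (forall i, measurable_fun setT (fun a => H a 0 i)) ->
  let F z := q (X z) + dotr (H (X z)) (D z) in
  {ae mu, forall z, 0 <= F z} ->
  {ae mu, forall z, 0 <= q (X z)} /\
  (\int[mu]_z `|(F z)%:E| <= \int[mu]_z `|(q (X z))%:E|)%E.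
Proof.
move=> fin_mu Di D0 mq mH F F0.
(* [N] dominates [q] and every coordinate of [H], so both are bounded on its sublevel sets [B k],
   which exhaust the space. *)
pose N a := `|q a| + \sum_(i < n) `|H a 0 i|.
have mN : measurable_fun setT N.
  apply: measurable_funD; first exact: measurableT_comp.
  by apply: measurable_sum => i; exact: measurableT_comp.
pose B k := N @^-1` `]-oo, k%:R].
have mB k : measurable (B k).
  by rewrite -[X in measurable X]setTI; exact: mN.
have BP k a : B k a -> `|q a| <= k%:R /\ forall i, `|H a 0 i| <= k%:R.
  rewrite /B /= in_itv/= /N => Nk.
  have H0 : 0 <= \sum_(i < n) `|H a 0 i| by apply: sumr_ge0.
  split=> [|i]; first by apply: le_trans Nk; rewrite lerDl.
  apply: le_trans Nk; rewrite (bigD1 i)//= addrCA lerDl addr_ge0//.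
  exact: sumr_ge0.
have exB a : exists k, B k a.
  exists (Num.trunc (N a)).+1.
  by rewrite /B/= in_itv/= ltW// truncnS_gt.
have mqX : measurable_fun setT (q \o X) by exact: measurableT_comp.
have key k A : measurable A -> A `<=` B k ->
    [/\ mu.-integrable (X @^-1` A) (fun z => (q (X z))%:E),
        mu.-integrable (X @^-1` A) (fun z => (F z)%:E) &
    (\int[mu]_(z in X @^-1` A) (F z)%:E =
     \int[mu]_(z in X @^-1` A) (q (X z))%:E)%E].
  move=> mA AB; have mXA := measurable_preim mA.
  have qi : mu.-integrable (X @^-1` A) (fun z => (q (X z))%:E).
    apply: measurable_bounded_integrable => //.
    - by apply: le_lt_trans fin_mu; apply: le_measure; rewrite ?inE.
    - exact: measurable_funTS.
    - exists k%:R; split; first exact: num_real.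
      by move=> M kM z /= /AB/BP[qk _]; rewrite (le_trans qk)// ltW.
  have O i : mu.-integrable (X @^-1` A) (fun z => (H (X z) 0 i * D z 0 i)%:E) /\
      (\int[mu]_(z in X @^-1` A) (H (X z) 0 i * D z 0 i)%:E = 0)%E.
    apply: (integral_mul_bounded_eq0 (Di i) (D0 i) mA (mH i) (M := k%:R)).
    by move=> a /AB/BP[_]; exact.
  have Ti : mu.-integrable (X @^-1` A) (fun z => (dotr (H (X z)) (D z))%:E).
    under eq_fun do rewrite /dotr -sumEFin.
    by apply: integrable_sum => // i _; exact: (O i).1.
  split => //; first by under eq_fun do rewrite EFinD; exact: integrableD.
  under eq_integral do rewrite EFinD; rewrite integralD//.
  under [X in (_ + X)%E]eq_integral do rewrite /dotr -sumEFin.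
  rewrite integral_sum// => [|i]; last exact: (O i).1.
  by rewrite big1 ?adde0// => i _; exact: (O i).2.
have mF : measurable_fun setT F.
  apply: measurable_funD => //; apply: measurable_sum => i.
  apply: measurable_funM; first by apply: (measurableT_comp (mH i)).
  by apply/measurable_EFinP; exact: (measurable_int mu (Di i)).
split.
  (* On a bounded piece where [q < 0], the integral of [q] equals that of [F >= 0], so [q] vanishes
     almost everywhere there and the piece is null. *)
  pose A k := B k `&` q @^-1` `]-oo, 0[.
  have mA k : measurable (A k).
    by apply: measurableI => //; rewrite -[X in measurable X]setTI; exact: mq.
  suff An k : mu.-negligible (X @^-1` A k).
    apply: negligibleS (negligible_bigcup An) => z /= /negP; rewrite -ltNge => qz.
    by have [k Bk] := exB (X z); exists k => //; split => //=; rewrite in_itv.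
  have [qi Fi E] := key k _ (mA k) (@subIsetl _ _ _).
  have mXA := measurable_preim (mA k).
  have : ae_eq mu (X @^-1` A k) (fun z => (q (X z))%:E) (cst 0%E).
    apply/ae_eq_integral_abs => //; first exact: (measurable_int mu qi).
    apply/eqP; rewrite eq_le integral_ge0// andbT.
    rewrite (eq_integral (fun z => - (q (X z))%:E)%E) => [|z]; last first.
      by move=> /set_mem[_ qz]; rewrite lte0_abs.
    rewrite integralN -?E; last exact: integrable_add_def.
    rewrite leeNl oppe0 (ae_eq_integral (fun z => `|(F z)%:E|%E))//.
    - exact: integral_ge0.
    - exact: (measurable_int mu Fi).
    - by apply: measurableT_comp => //; exact: (measurable_int mu Fi).
    - by apply: filterS F0 => z z0 _; rewrite gee0_abs.
  apply: negligibleS => z /= Az /(_ Az) [qz].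
  by case: Az => _ /=; rewrite in_itv/= qz ltxx.
have mXB k := measurable_preim (mB k).
(* Monotone convergence along [B k] carries the local bound to the whole space, possibly with
   infinite integrals. *)
have cvF : (\int[mu]_(z in X @^-1` B k) `|(F z)%:E|)%E @[k --> \oo] -->
    (\int[mu]_(z in \bigcup_k X @^-1` B k) `|(F z)%:E|)%E.
  apply: ge0_nondecreasing_set_cvg_integral => //.
  - move=> k l kl; apply/subsetPset => z.
    rewrite /B/= !in_itv/= => /le_trans; apply.
    by rewrite ler_nat.
  - move=> k; apply: measurable_funTS; apply/measurableT_comp => //.
    exact/measurable_EFinP.
rewrite (_ : \bigcup_k _ = setT) in cvF; last first.
  by apply/seteqP; split => // z _; have [k Bk] := exB (X z); exists k.
apply: (cvge_to_le cvF); apply: nearW => k.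
have [qi Fi E] := key k _ (mB k) (@subset_refl _ _).
rewrite (ae_eq_integral (fun z => (F z)%:E))//.
- rewrite E.
    apply: le_trans (ge0_subset_integral mu (mXB k) measurableT _ _ (@subsetT _ _)) => //.
      by apply: (le_integral (mXB k) qi (integrable_abse qi)) => z _; exact: lee_abs.
    by apply/measurableT_comp => //; exact/measurable_EFinP.
- by apply: measurableT_comp => //; exact: (measurable_int mu Fi).
- exact: (measurable_int mu Fi).
- by apply: filterS F0 => z z0 _; rewrite gee0_abs.
Qed.

End conditional_orthogonality.

(** * Comparison of integrals, Borel measurability and countable covers of the space of row
    vectors *)

Lemma ae_le_integral {disp : measure_display} {T : measurableType disp}
    {R : realType} (mu : {measure set T -> \bar R}) (D : set T)
    (f g : T -> \bar R) :
  measurable D -> measurable_fun D f -> measurable_fun D g ->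
  {ae mu, forall z, D z -> (f z <= g z)%E} ->
  (\int[mu]_(z in D) f z <= \int[mu]_(z in D) g z)%E.
Proof.
(* Positive and negative parts are compared separately, which covers non-integrable functions. *)
move=> mD mf mg fg; rewrite [leLHS]integralE [leRHS]integralE; apply: leeB.
- apply: ae_ge0_le_integral => //; [exact: measurable_funepos..|].
  by apply: filterS fg => z fgz Dz; rewrite !funeposE ge_max !le_max lexx fgz ?orbT.
- apply: ae_ge0_le_integral => //; [exact: measurable_funeneg..|].
  apply: filterS fg => z fgz Dz.
  by rewrite !funenegE ge_max !le_max lexx leeN2 fgz ?orbT.
Qed.

Lemma continuous_measurable_rV (R : realType) L (f : 'rV[R]_L -> R) :
  continuous f -> measurable_fun setT f.
Proof.
move=> cf; apply: (measurability _ (RGenOpens.measurableE R)).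
move=> _ [_ [a [b ->]] <-]; rewrite setTI.
apply: sub_sigma_algebra; apply: open_comp => [x _|]; first exact: cf.
exact: interval_open.
Qed.

Lemma open_measurable_rV (R : realType) L (A : set 'rV[R]_L) :
  open A -> measurable A.
Proof. by move=> oA; exact: sub_sigma_algebra. Qed.

(* Balls with rational centres and radii on which [f] varies by at most [e]. *)
Lemma small_oscillation_cover (R : realType) L (f : 'rV[R]_L -> R) (e : R) :
  continuous f -> 0 < e -> exists (A : (set 'rV[R]_L)^nat),
  [/\ forall k, measurable (A k), \bigcup_k A k = setT &
   forall k, exists (r : 'rV[R]_L) (rho : R),
     (forall a, A k a -> forall i, `|a 0 i - r 0 i| <= rho) /\
     forall a b : 'rV[R]_L, A k a -> (forall i, `|b 0 i - r 0 i| <= rho) ->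
       f a <= f b + e].
Proof.
move=> cf e0.
pose I := ('rV[rat]_L * nat)%type.
pose c (j : I) : 'rV[R]_L := map_mx ratr j.1.
pose rad (j : I) : R := j.2.+1%:R^-1.
(* [b] ranges over the closed box, because the mean of a cell need not lie in the cell. *)
pose good (j : I) := forall a b : 'rV[R]_L, ball (c j) (rad j) a ->
  (forall i, `|b 0 i - c j 0 i| <= rad j) -> f a <= f b + e.
pose A k := if unpickle k is Some j then
  (if `[<good j>] then ball (c j) (rad j) else set0) else set0.
exists A; split.
- move=> k; rewrite /A; case: unpickle => [j|]; last exact: measurable0.
  case: ifP => _; last exact: measurable0.
  by apply: open_measurable_rV; exact: ball_open.
- apply/seteqP; split => // a _.
  have e2 : 0 < e / 2 by rewrite divr_gt0.
  have /cvgrPdist_le/(_ _ e2)/nbhs_ballP[d /= d0 Hd] := cf a.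
  (* With radius below [d / 2], a box whose centre is that close to [a] stays within distance [d] of
     [a]. *)
  pose n := Num.trunc (2 / d).
  have nd : n.+1%:R^-1 < d / 2.
    by rewrite -[d / 2]invrK ltf_pV2 ?posrE ?invr_gt0 ?divr_gt0// invf_div truncnS_gt.
  have n0 : 0 < n.+1%:R^-1 :> R by rewrite invr_gt0.
  have rat_near i : exists q : rat, `|a 0 i - ratr q| < n.+1%:R^-1.
    move: n.+1%:R^-1 n0 => x x0.
    have /rat_in_itvoo[q] : a 0 i - x < a 0 i + x by lra.
    by rewrite in_itv/= => /andP[h1 h2]; exists q; rewrite ltr_norml; lra.
  pose q i := projT1 (cid (rat_near i)).
  have qP i : `|a 0 i - ratr (q i)| < n.+1%:R^-1 by exact: (projT2 (cid (rat_near i))).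
  pose j : I := (\row_i q i, n).
  have cE i : c j 0 i = ratr (q i) by rewrite !mxE.
  have aj : ball (c j) (rad j) a.
    by split=> // i k; rewrite ord1 cE /ball/= distrC; exact: qP.
  exists (pickle j) => //; rewrite /A pickleK; case: ifPn => // /asboolPn; case.
  have osc (b : 'rV[R]_L) : (forall i, `|b 0 i - c j 0 i| <= rad j) -> `|f a - f b| <= e / 2.
    move=> bj; apply: Hd; split=> // i k; rewrite ord1 /ball/=.
    have -> : a 0 k - b 0 k = (a 0 k - c j 0 k) - (b 0 k - c j 0 k) by ring.
    apply: le_lt_trans (ler_normB _ _) _; rewrite [d]splitr.
    by apply: ltrD; [rewrite cE; exact: lt_trans nd|exact: le_lt_trans nd].
  move=> x y xj yj.
  have /osc : forall i, `|x 0 i - c j 0 i| <= rad j.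
    by move=> i; case: xj => _ /(_ 0 i); rewrite /ball/= distrC => /ltW.
  have := osc _ yj; rewrite !ler_norml; lra.
- move=> k; rewrite /A; case: unpickle => [j|]; last by exists 0, 0; split => a [].
  case: ifPn => [/asboolP gj|_]; last by exists 0, 0; split => a [].
  exists (c j), (rad j); split => // a [_ aj] i.
  by have := aj 0 i; rewrite /ball/= distrC => /ltW.
Qed.

(** * Jensen's inequality for [w] when [X] is the conditional mean of [Y] *)

Section conditional_jensen.
Context {disp : measure_display} {T : measurableType disp} {R : realType} {L : nat}.
Local Notation V := 'rV[R]_L.
Variables (P : probability T R) (X Y : T -> V) (S : set V).
Hypothesis mX : measurable_fun setT X.
Hypothesis X_int : forall i, P.-integrable setT (fun z => (X z 0 i)%:E).
Hypothesis Y_int : forall i, P.-integrable setT (fun z => (Y z 0 i)%:E).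
Hypothesis XY : forall i A, measurable A ->
  (\int[P]_(z in X @^-1` A) (Y z 0 i)%:E = \int[P]_(z in X @^-1` A) (X z 0 i)%:E)%E.
Hypothesis YS : {ae P, forall z, S (Y z)}.
Variables (w : V -> R) (k : T -> R).
Hypothesis cw : continuous w.
Hypothesis mk : measurable_fun setT k.
Hypothesis k0 : forall z, 0 <= k z.
(** Convexity enters through affine minorants of [k] chosen for each [b] and [e], so that no
    supremum of uncountably many functions has to be measured. *)
Hypothesis w_sup : forall b, conv_hull S b -> forall e, 0 < e ->
  exists c h, w b <= c + dotr h b + e /\ {ae P, forall z, c + dotr h (Y z) <= k z}.

(** The witness is the mean of [Y] over the cell, which by [XY] is also the mean of [X]. As a mean
    of [X] it stays in the box around [r]; as a mean of [Y] it lies in [conv_hull S], where [w_sup]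
    applies. *)
Let cell_mean (A : set V) (r : V) (rho : R) : measurable A ->
  (0 < P (X @^-1` A))%E ->
  (forall a, A a -> forall i, `|a 0 i - r 0 i| <= rho) ->
  exists2 b : V, forall i, `|b 0 i - r 0 i| <= rho &
    ((w b)%:E * P (X @^-1` A) <= \int[P]_(z in X @^-1` A) (k z)%:E)%E.
Proof.
move=> mA; set D := X @^-1` A => D0 Ar.
have mD : measurable D by exact: measurable_preim.
have Xi i : P.-integrable D (fun z => (X z 0 i)%:E).
  exact: integrableS (X_int i).
have Yi i : P.-integrable D (fun z => (Y z 0 i)%:E).
  exact: integrableS (Y_int i).
have PDf : P D \is a fin_num by exact: fin_num_measure.
pose m := fine (P D); have Pm : P D = m%:E by rewrite fineK.
have m0 : 0 < m by rewrite -lte_fin -Pm.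
have ci (c : R) : P.-integrable D (fun=> c%:E).
  by apply: finite_measure_integrable_cst.
have cint (c : R) : (\int[P]_(z in D) c%:E = (c * m)%:E)%E.
  by rewrite integral_cst// EFinM -Pm.
pose b : V := \row_i (fine (\int[P]_(z in D) (Y z 0 i)%:E) / m).
have Yb i : (\int[P]_(z in D) (Y z 0 i)%:E = (b 0 i * m)%:E)%E.
  by rewrite mxE divfK ?gt_eqF// fineK// integrable_fin_num.
have Xb i : (\int[P]_(z in D) (X z 0 i)%:E = (b 0 i * m)%:E)%E.
  by rewrite -Yb XY.
exists b => [i|].
  have lo : (r 0 i - rho) * m <= b 0 i * m.
    rewrite -lee_fin -cint -Xb; apply: le_integral => // z /set_mem/Ar/(_ i).
    by rewrite lee_fin ler_norml; lra.
  have hi : b 0 i * m <= (r 0 i + rho) * m.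
    rewrite -lee_fin -Xb -cint; apply: le_integral => // z /set_mem/Ar/(_ i).
    by rewrite lee_fin ler_norml; lra.
  by move: lo hi; rewrite !ler_pM2r// ler_norml; lra.
have bS : conv_hull S b.
  (* Centring [Y] at [b] and translating [S] reduces to mean zero. *)
  have [||| n [u [x [u0 [u1 [Sx E]]]]]] :=
      @zero_mean_in_conv_hull _ _ _ P D mD D0 _ (fun z => Y z - b) [set x | S (x + b)].
  - move=> i; apply: (eq_integrable mD (fun z => (Y z 0 i)%:E - (b 0 i)%:E)%E).
      by move=> z _; rewrite !mxE.
    exact: integrableB.
  - move=> i; rewrite (eq_integral (fun z => (Y z 0 i)%:E - (b 0 i)%:E)%E).
      by rewrite integralB// Yb cint subee.
    by move=> z _; rewrite !mxE.
  - by apply: filterS YS => z Sz _ /=; rewrite subrK.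
  exists n, u, (fun j => x j + b); split => //; split => //; split => //.
  under eq_bigr do rewrite scalerDr.
  by rewrite big_split/= -E add0r -scaler_suml u1 scale1r.
have mkD : measurable_fun D (EFin \o k) by exact/measurable_EFinP/measurable_funTS.
apply/lee_addgt0Pr => e e0.
(* Over a cell of mass [m], an error [e / m] integrates to [e]. *)
have em0 : 0 < e / m by rewrite divr_gt0.
have [c [h [wb hk]]] := w_sup bS em0.
have aff_i : P.-integrable D (fun z => (c + dotr h (Y z))%:E).
  under eq_fun do rewrite EFinD; apply: integrableD => //.
  exact: integrable_dotr.
have aff_int : (\int[P]_(z in D) (c + dotr h (Y z))%:E = ((c + dotr h b) * m)%:E)%E.
  under eq_integral do rewrite EFinD.
  rewrite integralD//; last exact: integrable_dotr.
  rewrite cint integral_dotr// mulrDl EFinD; congr (_ + _)%E.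
  rewrite /dotr mulr_suml -sumEFin; apply: eq_bigr => i _.
  by rewrite Yb -EFinM mulrA.
have : (((c + dotr h b) * m)%:E <= \int[P]_(z in D) (k z)%:E)%E.
  rewrite -aff_int; apply: ae_le_integral => //.
    exact: (measurable_int P aff_i).
  by apply: filterS hk => z hz _; rewrite lee_fin.
rewrite Pm -EFinM => /(leeD2r e%:E); apply: le_trans; rewrite -EFinD lee_fin.
have -> : e = e / m * m by rewrite divfK ?gt_eqF.
by rewrite -mulrDl ler_pM2r.
Qed.

(** On disjoint cells of small oscillation the integrand exceeds its value at the point given by
    [cell_mean] by at most [e], and these errors sum to [e] because [P] has mass 1. *)
Lemma conditional_jensen :
  (\int[P]_z (Num.max 0 (w (X z)))%:E <= \int[P]_z (k z)%:E)%E.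
Proof.
apply/lee_addgt0Pr => e e0.
(* The positive part makes the integral countably additive over the cells; where [w b < 0] the cell
   bound is trivial, as [k >= 0]. *)
pose f a := Num.max 0 (w a).
have cf : continuous f.
  move=> a; apply: (@continuous_max R V (cst 0) w a); last exact: cw.
  exact: (@cst_continuous _ R^o).
have [A [mA A_T AP]] := small_oscillation_cover cf e0.
pose D j := X @^-1` seqDU A j.
have mC j : measurable (seqDU A j) by exact: seqDU_measurable.
have mD j : measurable (D j) by exact: measurable_preim.
have D_T : \bigcup_j D j = setT.
  by rewrite -preimage_bigcup -seqDU_bigcup_eq A_T preimage_setT.
have tD : trivIset setT D.
  by move=> i j _ _ [z [Di Dj]]; apply: (trivIset_seqDU A) => //; exists (X z).
have mfX : measurable_fun setT (fun z => (f (X z))%:E).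
  by apply/measurable_EFinP/(measurableT_comp (continuous_measurable_rV cf)).
have mke : measurable_fun setT (fun z => (k z + e)%:E).
  by apply/measurable_EFinP/measurable_funD.
have f0 a : 0 <= f a by rewrite le_max lexx.
have -> : (\int[P]_z (k z)%:E + e%:E = \int[P]_z (k z + e)%:E)%E.
  under [RHS]eq_integral do rewrite EFinD.
  rewrite ge0_integralD// ?integral_cst//.
  - by congr (_ + _)%E; rewrite -[LHS]mule1 -(probability_setT P).
  - by move=> z _; rewrite lee_fin.
  - exact/measurable_EFinP.
  - by move=> z _; rewrite lee_fin ltW.
have split_int (h : T -> \bar R) : measurable_fun setT h -> (forall z, 0 <= h z)%E ->
    (\int[P]_z h z = \sum_(0 <= j <oo) \int[P]_(z in D j) h z)%E.
  by move=> mh h0; rewrite -ge0_integral_bigcup// D_T.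
rewrite !split_int//; last 2 first.
- by move=> z; rewrite lee_fin addr_ge0// ltW.
- by move=> z; rewrite lee_fin; exact: f0.
apply: lee_nneseries => [j _ _|j _].
  by apply: integral_ge0 => z _; rewrite lee_fin; exact: f0.
have mkeD : measurable_fun (D j) (fun z => (k z + e)%:E) by exact: measurable_funTS.
have mfD : measurable_fun (D j) (fun z => (f (X z))%:E) by exact: measurable_funTS.
have [PD0|PDj] := eqVneq (P (D j)) 0%E.
  apply: ae_le_integral => //; exists (D j); split => // z /= nz.
  by apply: contrapT => nD; apply: nz => /nD.
have PD_gt0 : (0 < P (D j))%E by rewrite lt0e PDj measure_ge0.
have [r [rho [Ar Af]]] := AP j.
have CA a : seqDU A j a -> A j a by exact: subset_seqDU.
have [b br wb] := cell_mean (mC j) PD_gt0 (fun a Ca => Ar a (CA a Ca)).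
have fb : ((f b)%:E * P (D j) <= \int[P]_(z in D j) (k z)%:E)%E.
  rewrite /f; case: (leP 0 (w b)) => // _.
  by rewrite mul0e integral_ge0// => z _; rewrite lee_fin.
under [leRHS]eq_integral do rewrite EFinD.
rewrite ge0_integralD//.
- rewrite integral_cst//; apply: le_trans (leeD2r _ fb).
  rewrite -ge0_muleDl ?lee_fin ?(ltW e0)// -EFinD -integral_cst//.
  apply: ae_le_integral => //; apply: aeW => z Dz; rewrite lee_fin; apply: Af => //; exact: CA.
- by move=> z _; rewrite lee_fin.
- by apply/measurable_EFinP; exact: measurable_funTS.
- by move=> z _; rewrite lee_fin ltW.
Qed.

End conditional_jensen.

(** * Sums with an integrable term, and integration against a marginal *)

Lemma integral_ge0D {disp : measure_display} {T : measurableType disp}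
    {R : realType} (mu : {measure set T -> \bar R}) (u l : T -> R) :
  measurable_fun setT u -> (forall z, 0 <= u z) ->
  mu.-integrable setT (EFin \o l) ->
  (\int[mu]_z (u z + l z)%:E = \int[mu]_z (u z)%:E + \int[mu]_z (l z)%:E)%E.
Proof.
move=> mu_ u0 li.
have ml : measurable_fun setT l by apply/measurable_EFinP/(measurable_int mu li).
have mul : measurable_fun setT (fun z => (u z + l z)%:E).
  by apply/measurable_EFinP/measurable_funD.
have l_fin := integrable_fin_num measurableT li.
have labs_fin : (\int[mu]_z `|(l z)%:E| < +oo)%E by case/integrableP : li.
have mlabs : measurable_fun setT (fun z => `|(l z)%:E|%E).
  by apply/measurableT_comp => //; exact/measurable_EFinP.
(* If [u] has infinite integral, both sides are [+oo]: with [v = u + l], the bound [u <= v^\+ + |l|]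
   makes the positive part infinite, while [v^\- <= |l|] keeps the negative part finite. *)
have [uy|uy] := eqVneq (\int[mu]_z (u z)%:E)%E +oo%E; last first.
  under eq_integral do rewrite EFinD.
  apply: integralD => //; apply/integrableP; split; first exact/measurable_EFinP.
  by rewrite (eq_integral (EFin \o u)) ?ltey// => z _; rewrite gee0_abs// lee_fin.
rewrite uy addye ?fin_num_ltNye//; last first.
  by move: l_fin; rewrite fin_numE => /andP[].
rewrite integralE.
set v := fun z => (u z + l z)%:E.
have mpos : measurable_fun setT (v^\+)%E by exact: measurable_funepos.
have mneg : measurable_fun setT (v^\-)%E by exact: measurable_funeneg.
have pos_y : (\int[mu]_z v^\+ z = +oo)%E.
  apply/eqP; rewrite eq_sym; apply: contraT => pos_fin.
  have : (\int[mu]_z (u z)%:E < +oo)%E; last by rewrite uy.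
  apply: (@le_lt_trans _ _ (\int[mu]_z (v^\+ z + `|(l z)%:E|))%E); last first.
    by rewrite ge0_integralD// lte_add_pinfty// ltey eq_sym.
  apply: ae_le_integral => //; [exact/measurable_EFinP|exact: emeasurable_funD|].
  apply: aeW => z _; rewrite funeposE /v -EFin_max -EFinD lee_fin.
  have : u z + l z <= Num.max (u z + l z) 0 by rewrite le_max lexx.
  by have := ler_norm (- l z); rewrite normrN; lra.
rewrite pos_y addye// gt_eqF// lteNr /= (le_lt_trans _ labs_fin)//.
apply: ae_le_integral => //; apply: aeW => z _.
rewrite funenegE /v -EFinN -EFin_max lee_fin ge_max normr_ge0 andbT.
by have := ler_norm (- l z); have := u0 z; rewrite normrN; lra.
Qed.

(** Change of variables along the projection for nonnegative functions, then positive and negative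
    parts. *)
Lemma integral_snd_marginal {d1 d2 : measure_display} {T : measurableType d1}
    {U : measurableType d2} {R : realType} (p : {measure set U -> \bar R})
    (mu : {measure set (T * U) -> \bar R}) (u : U -> \bar R) :
  (forall B, measurable B -> mu (setT `*` B) = p B) ->
  measurable_fun setT u ->
  (\int[mu]_z u z.2 = \int[p]_x u x)%E.
Proof.
move=> mup mu_.
have ge0E (v : U -> \bar R) : measurable_fun setT v -> (forall x, 0 <= v x)%E ->
    (\int[mu]_z v z.2 = \int[p]_x v x)%E.
  move=> mv v0.
  have := ge0_integral_pushforward (@measurable_snd _ _ T U) mu measurableT mv
    (fun x _ => v0 x).
  rewrite preimage_setT => <-.
  apply: eq_measure_integral => A mA _.
  rewrite /pushforward -mup//; congr (mu _).
  by apply/seteqP; split => [[x y]|[x y] []].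
rewrite [LHS]integralE [RHS]integralE; congr (_ - _)%E.
- rewrite -(ge0E (u^\+)%E)//; last exact: measurable_funepos.
  by apply: eq_integral => z _; rewrite !funeposE.
- rewrite -(ge0E (u^\-)%E)//; last exact: measurable_funeneg.
  by apply: eq_integral => z _; rewrite !funenegE.
Qed.

(** * Tangent affine maps of [W] and their relation to the cost *)

Section tangent.
Context {R : realType} {L : nat}.
Local Notation V := 'rV[R]_L.
Variables (W : V -> R).
Hypothesis C3W : C3 W.

Definition grad (a : V) : V := \row_i partial i W a.
Definition tangent (a b : V) : R := W a + dotr (grad a) (b - a).

Lemma costE a b : cost W a b = W b - tangent a b.
Proof.
have [_ H] := C3W.
rewrite /cost (C1_diffE (fun i => (H i).1) (fun i => (H i).2.1)) -/(grad a).
by rewrite -[a - b]opprB linearN /= /tangent opprD addrA.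
Qed.

Lemma tangent_affine a b : tangent a b = tangent a 0 + dotr (grad a) b.
Proof. by rewrite /tangent linearB /= sub0r linearN /= -addrA addrC; ring. Qed.

Lemma tangent_continuous a : continuous (tangent a).
Proof.
have -> : tangent a = (fun b => tangent a 0 + dotr (grad a) b).
  by apply/funext => b; exact: tangent_affine.
by move=> b; exact: (cvgD (cvg_cst _) (@dotr_continuous _ _ (grad a) b)).
Qed.

Lemma partial_measurable i : measurable_fun setT (partial i W).
Proof.
by have [_ H] := C3W; apply: continuous_measurable_rV; exact: (H i).2.1.
Qed.

End tangent.

(** * Optimality of the feature map *)

Theorem theorem7 (R : realType) (L : nat)
  (Xset : set 'rV[R]_L) (p : probability 'rV[R]_L R)
  (g : 'rV[R]_L -> 'rV[R]_L) (W : 'rV[R]_L -> R)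
  (Xi : set 'rV[R]_L) (Afeat : 'rV[R]_L -> 'rV[R]_L)
  (gam : probability ('rV[R]_L * 'rV[R]_L)%type R) :
  measurable Xset -> p Xset = 1%E -> has_lebesgue_density p ->
  measurable_fun Xset g -> C3 W ->
  maximal W (conv_hull (g @` Xset)) Xi ->
  measurable_fun setT Afeat ->
  (forall E, measurable E -> gam E = p ((fun x => (Afeat x, x)) @^-1` E)) ->
  {ae gam, forall z, proj_set W Xi (g z.2) z.1} ->
  cond_exp_is_id g gam ->
  optimal_autoencoder p g W gam.
Proof.
move=> mXset pXset _ _ C3W maxXi mAfeat gamE projXi ceg.
have mgraph : measurable_fun setT (fun x : 'rV[R]_L => (Afeat x, x)).
  exact: measurable_fun_pair.
have marg B : measurable B -> gam (setT `*` B) = p B.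
  move=> mB; rewrite gamE; last exact: measurableX.
  by congr (p _); apply/seteqP; split => [x []//|x Bx]; split.
split; first by split.
move=> gam' [marg' ceg'].
have cW : continuous W by case: C3W.
have [a0 Xia0] : Xi !=set0.
  apply: (@ae_nonempty _ _ _ gam setT _ fst) => //.
    by apply: (lt_le_trans lte01); rewrite -(probability_setT gam).
  by apply: filterS projXi => z [].
pose q a := W a - tangent W a0 a.
have cq : continuous q.
  by move=> a; exact: (cvgB (cW a) (@tangent_continuous _ _ W a0 a)).
have mq := continuous_measurable_rV cq.
(* Integrability under [gam] includes measurability in [z]; restricting to the slice with first
   component 0 makes [g] measurable on the whole space. *)
have mg i : measurable_fun setT (fun x => g x 0 i).
  have [/(_ i) gi _] := ceg.
  have /measurable_EFinP mgi := measurable_int gam gi.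
  have m0 : measurable_fun setT (fun x : 'rV[R]_L => (0 : 'rV[R]_L, x)).
    exact: measurable_fun_pair.
  exact: (measurableT_comp mgi m0).
(* Almost surely [z.1] realises the supremum of the tangents at [g z.2], so [F] is
   [phi (g z.2) - tangent W a0 (g z.2)], nonnegative because [a0] competes. *)
pose F z := tangent W z.1 (g z.2) - tangent W a0 (g z.2).
(* Expanding both tangents about [z.1] gives the form required by [cond_exp_nonneg], since
   [g z.2 - z.1] has conditional mean zero. *)
have FE : F = fun z => q z.1 + dotr (grad W z.1 - grad W a0) (g z.2 - z.1).
  apply/funext => z; rewrite /F /q /tangent; set u := grad W z.1; set v := grad W a0.
  rewrite (dotrC (u - v)) !linearB /= !(dotrC _ u) !(dotrC _ v) !linearB /=.
  ring.
have F0 : {ae gam, forall z, 0 <= F z}.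
  apply: filterS projXi => z [_ /(_ _ Xia0)]; rewrite !costE//.
  by rewrite lerD2l lerN2 subr_ge0.
have ortho (mu : probability ('rV[R]_L * 'rV[R]_L)%type R) : cond_exp_is_id g mu ->
    (forall i, mu.-integrable setT (fun z => ((g z.2 - z.1) 0 i)%:E)) /\
    (forall i A, measurable A ->
      \int[mu]_(z in fst @^-1` A) ((g z.2 - z.1) 0 i)%:E = 0)%E.
  move=> [gi [zi gz]].
  have E i : (fun z : 'rV[R]_L * 'rV[R]_L => ((g z.2 - z.1) 0 i)%:E) =
      (fun z => (g z.2 0 i)%:E - (z.1 0 i)%:E)%E.
    by apply/funext => z; rewrite !mxE.
  split=> [i|i A mA]; rewrite E; first exact: integrableB.
  have -> : fst @^-1` A = A `*` [set: 'rV[R]_L].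
    by apply/seteqP; split => [[x y]|[x y] []].
  have mAT : measurable (A `*` [set: 'rV[R]_L]) by exact: measurableX.
  have giA : mu.-integrable (A `*` setT) (fun z => (g z.2 0 i)%:E).
    exact: integrableS (gi i).
  have ziA : mu.-integrable (A `*` setT) (fun z => (z.1 0 i)%:E).
    exact: integrableS (zi i).
  by rewrite integralB// gz// subee// integrable_fin_num.
have [q0 Fq] : {ae gam, forall z, 0 <= q z.1} /\
    (\int[gam]_z `|(F z)%:E| <= \int[gam]_z `|(q z.1)%:E|)%E.
  have [Di D0] := ortho _ ceg.
  rewrite FE in F0 *.
  apply: (cond_exp_nonneg measurable_fst (H := fun a => grad W a - grad W a0)
    _ Di D0 mq _ F0).
    by apply: (@le_lt_trans _ _ 1%E); [rewrite -(probability_setT gam)|exact: ltry].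
  move=> i; under eq_fun do rewrite !mxE; apply: measurable_funB => //.
  exact: partial_measurable.
(* [K] turns [F] into a function of the data point alone, which can be integrated against any
   autoencoder; the absolute value makes it nonnegative everywhere. *)
pose K x := `|F (Afeat x, x)|.
have mfst (f : 'rV[R]_L -> R) : continuous f ->
    measurable_fun setT (fun z : 'rV[R]_L * 'rV[R]_L => f z.1).
  by move=> cf; exact: (measurableT_comp (continuous_measurable_rV cf) measurable_fst).
have mF : measurable_fun setT F.
  rewrite FE; apply: measurable_funD; first exact: mfst.
  apply: measurable_sum => i; under eq_fun do rewrite !mxE.
  apply: measurable_funM.
    apply: measurable_funB => //.
    exact: (measurableT_comp (partial_measurable C3W i)).
  apply: measurable_funB; first exact: (measurableT_comp (mg i)).
  exact: (mfst (fun M => M 0 i) (@coord_continuous R 1 L 0 i)).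
have mK : measurable_fun setT K.
  by apply: measurableT_comp => //; exact: (measurableT_comp mF mgraph).
have KF : (\int[p]_x (K x)%:E = \int[gam]_z `|(F z)%:E|)%E.
  have mabsF : measurable_fun setT (fun z => `|(F z)%:E|%E).
    by apply: measurableT_comp => //; exact/measurable_EFinP.
  have := ge0_integral_pushforward mgraph p measurableT mabsF
    (fun z _ => abse_ge0 _).
  rewrite preimage_setT => <-.
  by apply: eq_measure_integral => A mA _; apply/esym; exact: gamE.
have [N [mN gamN0 Nsub]] := projXi.
(* [gam] and [gam'] share only the marginal [p], so the exceptional set is pulled back to a [p]-null
   set of data points. *)
pose N' := (fun x => (Afeat x, x)) @^-1` N.
have mN' : measurable N' by exact: measurable_preim.
have pN' : p N' = 0%E by rewrite -gamE.
have good x : ~ N' x -> proj_set W Xi (g x) (Afeat x).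
  by move=> nN; apply: contrapT => np; apply: nN; exact: Nsub.
have qK : (\int[gam']_z (Num.max 0 (q z.1))%:E <= \int[gam']_z (K z.2)%:E)%E.
  have [gi' [zi' gz']] := ceg'.
  apply: (@conditional_jensen _ _ _ _ gam' fst (fun z => g z.2) (g @` Xset)) => //.
  - move=> i A mA.
    have -> : fst @^-1` A = A `*` [set: 'rV[R]_L].
      by apply/seteqP; split => [[x y]|[x y] []].
    exact: gz'.
  - exists (setT `*` ~` Xset); split.
    + by apply: measurableX => //; exact: measurableC.
    + rewrite marg'; last exact: measurableC.
      by rewrite probability_setC// pXset subee.
    + by move=> [x y] /= ny; split => //= Xy; apply: ny; exists y.
  - exact: measurableT_comp.
  - by move=> z; exact: normr_ge0.
  move=> b bS e e0.
  (* Maximality yields [a] in [Xi] of cost below [e] at [b]. The minorant is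
     [tangent W a - tangent W a0], which [K] dominates because [Afeat x] minimises the cost over
     [Xi]. *)
  have : (ereal_inf [set (cost W a b)%:E | a in Xi] < e%:E)%E.
    by apply: (le_lt_trans (maxXi b bS)); rewrite lte_fin.
  move=> /ereal_inf_lt[_ [a Xia <-]]; rewrite lte_fin costE// => ab.
  have affE y : tangent W a 0 - tangent W a0 0 + dotr (grad W a - grad W a0) y =
      tangent W a y - tangent W a0 y.
    rewrite (tangent_affine _ a y) (tangent_affine _ a0 y).
    by rewrite dotrC linearB /= !(dotrC y); ring.
  exists (tangent W a 0 - tangent W a0 0), (grad W a - grad W a0); split.
    by rewrite affE /q; move: ab; lra.
  exists (setT `*` N'); split.
  + exact: measurableX.
  + by rewrite marg'.
  + move=> [x y] /= /negP nle; split => //=; apply: contrapT => /good[_ /(_ _ Xia)].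
    move: nle; rewrite affE /K /F -ltNge !costE//=.
    have := ler_norm (tangent W (Afeat y) (g y) - tangent W a0 (g y)); lra.
have tangentE : (fun z : 'rV[R]_L * 'rV[R]_L => (tangent W a0 z.1)%:E) =
    (fun z => (tangent W a0 0)%:E + (dotr (grad W a0) z.1)%:E)%E.
  by apply/funext => z; rewrite tangent_affine.
have tangent_int (mu : probability ('rV[R]_L * 'rV[R]_L)%type R) :
    cond_exp_is_id g mu -> mu.-integrable setT (fun z => (tangent W a0 z.1)%:E).
  move=> [_ [zi _]]; rewrite tangentE; apply: integrableD => //.
    exact: finite_measure_integrable_cst.
  exact: integrable_dotr.
(* This value depends on [p] alone, so the subtracted tangent contributes equally for both
   autoencoders. *)
have int_tangent (mu : probability ('rV[R]_L * 'rV[R]_L)%type R) :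
    autoencoder p g mu -> (\int[mu]_z (tangent W a0 z.1)%:E =
    (tangent W a0 0)%:E + \sum_(i < L) (grad W a0 0 i)%:E * \int[p]_x (g x 0 i)%:E)%E.
  move=> [mmu [gi [zi gz]]]; rewrite tangentE integralD//; last 2 first.
  - exact: finite_measure_integrable_cst.
  - exact: integrable_dotr.
  congr (_ + _)%E.
    by rewrite integral_cst// -[RHS]mule1 -(probability_setT mu).
  rewrite integral_dotr//; apply: eq_bigr => i _; congr (_ * _)%E.
  rewrite -(integral_snd_marginal mmu); last exact/measurable_EFinP.
  by have := gz setT measurableT i; rewrite setXTT => ->.
have mmax : measurable_fun setT (fun z : 'rV[R]_L * 'rV[R]_L => Num.max 0 (q z.1)).
  by apply: measurable_maxr => //; exact: mfst.
have mtan : measurable_fun setT (fun z : 'rV[R]_L * 'rV[R]_L => tangent W a0 z.1).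
  by apply: mfst; exact: tangent_continuous.
have mabs : measurable_fun setT (fun z : 'rV[R]_L * 'rV[R]_L => `|q z.1|).
  by apply: measurableT_comp => //; exact: mfst.
have mWz : measurable_fun setT (fun z : 'rV[R]_L * 'rV[R]_L => (W z.1)%:E).
  by apply/measurable_EFinP; exact: mfst.
(* Under [gam'], [W] is only bounded by the positive part of [q] plus the tangent; under [gam],
   [q >= 0] almost everywhere turns [|q|] plus the tangent back into [W]. *)
apply: (@le_trans _ _ (\int[gam']_z (Num.max 0 (q z.1) + tangent W a0 z.1)%:E)%E).
  apply: ae_le_integral => //; first exact/measurable_EFinP/measurable_funD.
  apply: aeW => z _; rewrite lee_fin -lerBlDr -/(q z.1).
  by rewrite le_max lexx orbT.
rewrite (integral_ge0D mmax _ (tangent_int _ ceg')); last first.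
  by move=> z; rewrite le_max lexx.
apply: (@le_trans _ _ (\int[gam]_z (`|q z.1| + tangent W a0 z.1)%:E)%E).
  rewrite (integral_ge0D mabs _ (tangent_int _ ceg))//.
  rewrite !int_tangent// leeD2r// (le_trans qK)//.
  by rewrite (integral_snd_marginal marg' (u := EFin \o K)) ?KF//; exact/measurable_EFinP.
apply: ae_le_integral => //; first exact/measurable_EFinP/measurable_funD.
by apply: filterS q0 => z z0 _; rewrite lee_fin ger0_norm// subrK.
Qed.
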